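(* Let $\mathbb{F}_q$ be a finite field of characteristic $p > 3$, let $b \in \mathbb{F}_q^*$ be an element that is not a cube in $\mathbb{F}_q$, and assume that the elliptic curve $E_b\colon y_0^2 = x_0^3 - b$ over $\mathbb{F}_q$ is ordinary. Let $c \in (\mathbb{F}_q^* )^3$ with $c \notin (\mathbb{F}_q^* )^2$, and let $\sqrt[3]{c} \in \mathbb{F}_q$ be a cube root of $c$. Let $\mathcal{K}_6$ be the elliptic surface over $\mathbb{F}_q$ with affine equation $$(x_1^3 - b)\,t^6 = c\,(x_0^3 - b) \quad\subset\quad \mathbb{A}^3_{(x_0,x_1,t)},$$ fibered over $\mathbb{P}^1$ by $(x_0,x_1,t)\mapsto t$, with zero section $\mathcal{O} = (t^2 : \sqrt[3]{c} : 0)$. Then the Mordell--Weil group $\mathrm{MW}(\mathcal{K}_6)$ of sections defined over $\mathbb{F}_q$ is isomorphic to $\mathbb{Z}/3$.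
   Context: Homogeneous coordinates $(X_0:X_1:X_2)$ on $\mathbb{P}^2$ are related to the affine ones by $x_0 = X_0/X_2$, $x_1 = X_1/X_2$. An elliptic surface over $\mathbb{P}^1$ is identified with its generic fiber, an elliptic curve over the function field in one variable $t$. Thus $\mathcal{K}_6$ corresponds to the smooth plane cubic $$(X_1^3 - bX_2^3)\,t^6 = c\,(X_0^3 - bX_2^3) \quad\subset\quad \mathbb{P}^2$$ over $\mathbb{F}_q(t)$, made into an elliptic curve over $\mathbb{F}_q(t)$ by taking the $\mathbb{F}_q(t)$-point $\mathcal{O} = (t^2:\sqrt[3]{c}:0)$ as the identity element. Sections of the surface defined over $\mathbb{F}_q$ are the same as $\mathbb{F}_q(t)$-rational points of this cubic, and $\mathrm{MW}(\mathcal{K}_6)$ is the group of these $\mathbb{F}_q(t)$-rational points. Since $E_b$ has $j$-invariant $0$ and is ordinary, $q \equiv 1 \pmod 3$, so $\mathbb{F}_q$ contains a primitive cube root of unity. *)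

(* Defs.v *)
From mathcomp Require Import all_boot all_order all_algebra all_field.
From mathcomp Require Import mpoly.

Set Implicit Arguments.
Unset Strict Implicit.
Unset Printing Implicit Defensive.

Import GRing.Theory.
Local Open Scope ring_scope.

(* A K-point (X_0 : X_1 : X_2) of the projective plane is a one-dimensional
   subspace of K^3, a plane curve is given by a homogeneous polynomial C in
   'X_0, 'X_1, 'X_2. *)

Section PlaneCubic.
Variable K : fieldType.
Implicit Types (C : {mpoly K[3]}) (O P Q R S : {vspace 'rV[K]_3}).

Definition proj_pt (x0 x1 x2 : K) : {vspace 'rV[K]_3} :=
  <[ \row_(i < 3) [:: x0; x1; x2]`_i ]>%VS.

(* As C is homogeneous, whether it vanishes at P does not depend on the
   generator of P at which it is evaluated; vpick P is one of them. *)
Definition on_curve C P : bool :=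
  (\dim P == 1%N) && (C.@[vpick P 0] == 0).

Definition curve_pt C : Type := {P : {vspace 'rV[K]_3} | on_curve C P}.

(* The pullback of C along the parametrization (s : t) |-> (s, t) *m M of the
   line spanned by the rows of M: a binary form in s = 'X_0, t = 'X_1. *)
Definition restrict_line C (M : 'M[K]_(2, 3)) : {mpoly K[2]} :=
  C \mPo [tuple \sum_(k < 2) M k i *: 'X_k | i < 3].

(* The linear form in s, t vanishing exactly at (s : t) = (v_0 : v_1). *)
Definition root_form (v : 'rV[K]_2) : {mpoly K[2]} :=
  v 0 1 *: 'X_0 - v 0 0 *: 'X_1.

(* Some line meets the cubic C exactly in P + Q + R, counted with
   multiplicity. The condition k != 0 excludes lines contained in C. *)
Definition line_section C P Q R : Prop :=
  exists (M : 'M[K]_(2, 3)) (u v w : 'rV[K]_2) (k : K),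
    [/\ row_free M, [/\ u != 0, v != 0 & w != 0],
        [/\ P = <[u *m M]>%VS, Q = <[v *m M]>%VS & R = <[w *m M]>%VS],
        k != 0
      & restrict_line C M = k *: (root_form u * root_form v * root_form w)].

(* The chord-tangent law on a smooth cubic C with identity O, as the graph of
   addition: S = P + Q when S is the third intersection point of C with the
   line through O and R, R being the third intersection point of C with the
   line through P and Q (tangent lines when points coincide). *)
Definition cubic_add C O P Q S : Prop :=
  exists R, line_section C P Q R /\ line_section C O R S.

Inductive cubic_muln C O P : nat -> {vspace 'rV[K]_3} -> Prop :=
| Cubic_mul0 : cubic_muln C O P 0 O
| Cubic_mulS n S S' :
    cubic_muln C O P n S -> cubic_add C O S P S' -> cubic_muln C O P n.+1 S'.

(* The group of K-points of the smooth cubic C with identity O is isomorphic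
   to A. The equivalence says that the transported chord-tangent relation is
   precisely the graph of the addition of A. *)
Definition cubic_group_iso C O (A : zmodType) : Prop :=
  exists f : A -> curve_pt C,
    bijective f /\
    forall x y z : A,
      cubic_add C O (val (f x)) (val (f y)) (val (f z)) <-> z = x + y.

End PlaneCubic.

(* The projective closure of y_0^2 = x_0^3 - b, where (x_0, y_0) are
   X_0 / X_2 and X_1 / X_2, and its point at infinity. *)
Definition E_cubic (K : fieldType) (b : K) : {mpoly K[3]} :=
  'X_1 ^+ 2 * 'X_2 - ('X_0 ^+ 3 - b *: 'X_2 ^+ 3).

Definition E_zero (K : fieldType) : {vspace 'rV[K]_3} := proj_pt 0 1 0.

(* E_b over a field F of characteristic p is ordinary: it has a nonzero
   p-torsion point over an algebraic closure of F. *)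
Definition E_ordinary (F : fieldType) (p : nat) (b : F) : Prop :=
  exists (L : closedFieldType) (iota : {rmorphism F -> L}),
    integralRange iota /\
    exists P : {vspace 'rV[L]_3},
      [/\ on_curve (E_cubic (iota b)) P, P != E_zero L
        & cubic_muln (E_cubic (iota b)) (E_zero L) P p (E_zero L)].

Definition ratfun (F : fieldType) : fieldType := {fraction {poly F}}.

Definition ratC (F : fieldType) (a : F) : ratfun F := tofrac a%:P.

Definition ratX (F : fieldType) : ratfun F := tofrac 'X.

(* The generic fiber of K_6 and its zero section; r is a cube root of c. *)
Definition K6_cubic (F : fieldType) (b c : F) : {mpoly (ratfun F)[3]} :=
  ratX F ^+ 6 *: ('X_1 ^+ 3 - ratC b *: 'X_2 ^+ 3)
  - ratC c *: ('X_0 ^+ 3 - ratC b *: 'X_2 ^+ 3).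

Definition K6_zero (F : fieldType) (r : F) : {vspace 'rV[ratfun F]_3} :=
  proj_pt (ratX F ^+ 2) (ratC r) 0.

(* Main.v *)
Require Import Defs.
From mathcomp Require Import all_boot all_order all_algebra all_field.
From mathcomp Require Import mpoly ring zify.
Import GRing.Theory.
Local Open Scope ring_scope.
Set Implicit Arguments.
Unset Strict Implicit.
Unset Printing Implicit Defensive.

(** Why the theorem is true.

Put x = t^2 X_1 / X_2 and y = - r X_0 / X_2. Since c = r^3, the affine part of
the generic fiber becomes x^3 + y^3 = b (t^6 - r^3), while the line X_2 = 0
meets the cubic in the three points (omega^i t^2 : r : 0), where omega is a
primitive cube root of unity; it exists because cubing, which misses b, is not
injective on the finite field. The theorem amounts to two claims: the cubic has
no affine point, and the three points at infinity are collinear flexes, so that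
the chord-tangent law turns them into Z/3.

The first claim is a descent along the isogeny sqrt(-3), carried out in F[t].
Clearing denominators gives coprime x, y and a nonzero z with
x^3 + y^3 = b (t^6 - r^3) z^3. The left-hand side is the product of the
pairwise coprime polynomials X = x + y, Y = omega x + omega^2 y and
W = omega^2 x + omega y, whose sum is 0. As r is not a square, t^6 - r^3 is the
product of the irreducible quadratics t^2 - omega^i r, i = 0, 1, 2, and each of
these divides exactly one of X, Y, W. Up to these quadratics and constants
X, Y and W are cubes u^3, v^3, w^3, and the constants multiply to b up to a
cube. There are three kinds of distribution of the quadratics.

- Two in one factor and one in another: the degrees of X, Y, W are pairwise
  different modulo 3, so they cannot sum to 0 ([degree_mod3_contra]).

- One in each factor: modulo t^2 - omega^i r the other two factors are opposite,
  and the other two quadratics are constants. Taking norms from the quadratic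
  residue field to F, one learns that a quotient of two of the constants is a
  cube up to a power of omega ([cube_residue]). Combined, these conditions make
  the product of the constants a cube, whereas b is not one
  ([three_primes_apart]).

- All three in one factor: the same residue argument shows that v^3 and w^3 have
  the same coefficient up to a cube, and X + Y + W = 0 becomes
  v^3 + w^3 = b (t^6 - r^3) u^3 up to scaling. As u divides z, this is a solution
  with z of smaller degree ([all_primes_together]).

The last case cannot recur forever ([no_coprime_solution]).

For the second claim, [line_sectionP] extracts from a line section that the line
meets the cubic in no point besides the listed ones. A line through two of the
points at infinity contains the third, so three points at infinity form a line
section exactly when they are all equal or all different, that is, when their
indices sum to 0 modulo 3 ([line_section_inf_pt]). *)

(** * Pairwise coprime polynomials whose product is nearly a cube *)

Section CubesInPolynomials.
Variable F : fieldType.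
Implicit Types (A B C X Y Z W P : {poly F}).

(** With g = gcd(A, Z), A and g^3 divide each other: A / g is coprime to
Z / g, so it divides g^2, and g is coprime to B, so g^2 divides A / g. *)
Lemma coprime_mul_cube A B Z :
  A != 0 -> coprimep A B -> A * B = Z ^+ 3 ->
  exists2 a : F, a != 0 & exists u : {poly F}, A = a *: u ^+ 3.
Proof.
move=> A0 cAB eAB; set g := gcdp A Z.
have g0 : g != 0 by rewrite gcdp_eq0 (negPf A0).
have [A' eA] := dvdpP _ _ (dvdp_gcdl A Z : g %| A).
have [Z' eZ] := dvdpP _ _ (dvdp_gcdr A Z : g %| Z).
have cAZ : coprimep A' Z'.
  have := @coprimep_div_gcd F A Z; rewrite A0 -/g => /(_ isT).
  by rewrite {1}eA {1}eZ !mulpK.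
have cgB : coprimep g B := coprimep_dvdr (dvdp_gcdl A Z) cAB.
have E : A' * B = g ^+ 2 * Z' ^+ 3.
  apply: (mulIf g0); rewrite mulrAC -eA eAB eZ; ring.
have AE : A' %= g ^+ 2.
  apply/andP; split.
    rewrite -(Gauss_dvdpl _ (coprimep_expr 3 cAZ)) -E; exact: dvdp_mulr.
  rewrite -(Gauss_dvdpl _ (coprimep_expl 2 cgB)) E; exact: dvdp_mulr.
have A'0 : A' != 0 by apply: contraNneq A0 => A'0; rewrite eA A'0 mul0r.
exists (lead_coef A' / lead_coef (g ^+ 2)).
  by rewrite mulf_neq0 ?invr_eq0 ?lead_coef_eq0 // expf_neq0.
by exists g; rewrite {1}eA {1}(eqpfP AE) -scalerAl -exprSr.
Qed.

Definition pairwise_coprime X Y W :=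
  [&& coprimep X Y, coprimep Y W & coprimep W X].

Lemma pairwise_coprimeC X Y W :
  pairwise_coprime X Y W -> pairwise_coprime Y W X.
Proof. by case/and3P=> *; apply/and3P; split. Qed.

Lemma prime_factor_split P M X Y W :
  irreducible_poly P -> X * Y * W = P * M -> pairwise_coprime X Y W ->
  [\/ exists X1, [/\ X = P * X1, X1 * Y * W = M & pairwise_coprime X1 Y W],
      exists Y1, [/\ Y = P * Y1, X * Y1 * W = M & pairwise_coprime X Y1 W]
    | exists W1, [/\ W = P * W1, X * Y * W1 = M & pairwise_coprime X Y W1]].
Proof.
move=> irrP E /and3P[cXY cYW cWX]; have P0 := irredp_neq0 irrP.
have PdvdM A B : P %| A * B -> (P %| A) || (P %| B).
  move=> PAB; apply/orP; case: (boolP (P %| A)) => [|nA]; first by left.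
  by right; rewrite -(Gauss_dvdpr B (_ : coprimep P A)) // irreducible_poly_coprime.
have: P %| X * Y * W by rewrite E dvdp_mulr.
case/PdvdM/orP=> [/PdvdM/orP[]|] /dvdpP[A EA];
  move: EA; rewrite mulrC => EA; subst; [constructor 1|constructor 2|constructor 3];
  exists A; split=> //.
- by apply: (mulfI P0); rewrite -E; ring.
- move: cXY cWX; rewrite coprimepMl coprimepMr => /andP[_ ?] /andP[_ ?].
  by apply/and3P; split.
- by apply: (mulfI P0); rewrite -E; ring.
- move: cXY cYW; rewrite coprimepMl coprimepMr => /andP[_ ?] /andP[_ ?].
  by apply/and3P; split.
- by apply: (mulfI P0); rewrite -E; ring.
move: cWX cYW; rewrite coprimepMl coprimepMr => /andP[_ ?] /andP[_ ?].
by apply/and3P; split.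
Qed.

(** The relation between the constants comes from leading coefficients. *)
Lemma pairwise_coprime_mul_cube (b : F) X Y W Z :
  b != 0 -> Z != 0 -> pairwise_coprime X Y W -> X * Y * W = b *: Z ^+ 3 ->
  exists (a1 a2 a3 : F) (u v w : {poly F}),
   [/\ [/\ X = a1 *: u ^+ 3, Y = a2 *: v ^+ 3 & W = a3 *: w ^+ 3],
       [/\ a1 != 0, a2 != 0 & a3 != 0],
       [/\ u != 0, v != 0 & w != 0],
       exists2 e : F, e != 0 & a1 * a2 * a3 = b * e ^+ 3
     & size (u * v * w) = size Z].
Proof.
move=> b0 Z0 /and3P[cXY cYW cWX] E.
have: X * Y * W != 0 by rewrite E scaler_eq0 negb_or b0 expf_neq0.
rewrite !mulf_eq0 !negb_or => /andP[/andP[X0 Y0] W0].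
have cube A B : A != 0 -> coprimep A B -> A * B = X * Y * W ->
    exists2 a : F, a != 0 & exists u : {poly F}, A = a *: u ^+ 3.
  move=> A0 cAB EA; apply: (@coprime_mul_cube A (b^-1 *: B) Z) => //.
    by rewrite coprimepZr ?invr_eq0.
  by rewrite -scalerAr EA E scalerA mulVf // scale1r.
have [||a1 a10 [u Eu]] := cube X (Y * W) X0; rewrite ?coprimepMr ?cXY ?mulrA //.
  by rewrite coprimep_sym.
have [||a2 a20 [v Ev]] := cube Y (X * W) Y0; rewrite ?coprimepMr ?cYW ?andbT //.
- by rewrite coprimep_sym.
- ring.
have [||a3 a30 [w Ew]] := cube W (X * Y) W0; rewrite ?coprimepMr ?cWX //=.
- by rewrite coprimep_sym.
- ring.
have n0 a (z : {poly F}) : a *: z ^+ 3 != 0 -> z != 0.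
  by apply: contraNneq => ->; rewrite expr0n /= scaler0.
have u0 : u != 0 by apply: (n0 a1); rewrite -Eu.
have v0 : v != 0 by apply: (n0 a2); rewrite -Ev.
have w0 : w != 0 by apply: (n0 a3); rewrite -Ew.
have E3 : (a1 * a2 * a3) *: (u * v * w) ^+ 3 = b *: Z ^+ 3.
  by rewrite -E Eu Ev Ew -!mul_polyC !rmorphM /=; ring.
have uvw0 : u * v * w != 0 by rewrite !mulf_neq0.
exists a1, a2, a3, u, v, w; split=> //.
  have := congr1 (@lead_coef F) E3.
  rewrite !lead_coefZ !lead_coef_exp => E4.
  exists (lead_coef Z / lead_coef (u * v * w)).
    by rewrite mulf_neq0 ?invr_eq0 ?lead_coef_eq0.
  apply: (mulIf (expf_neq0 3 (_ : lead_coef (u * v * w) != 0))).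
    by rewrite lead_coef_eq0.
  by rewrite E4 expr_div_n -[RHS]mulrA divfK ?expf_neq0 ?lead_coef_eq0.
have := congr1 (fun p : {poly F} => (size p).-1) E3.
rewrite /= !size_scale ?mulf_neq0 // !size_exp.
move/eqP; rewrite eqn_pmul2r // => /eqP deg.
have p1 : (0 < size (u * v * w)%R)%N by rewrite size_poly_gt0.
have p2 : (0 < size Z)%N by rewrite size_poly_gt0.
by rewrite -(prednK p1) -(prednK p2) deg.
Qed.

Lemma sum3_eq0_size X Y W : X + Y + W = 0 ->
  [\/ size X = size Y, size Y = size W | size W = size X].
Proof.
move=> E; have EW : W = - (X + Y) by apply/eqP; rewrite -addr_eq0 addrC E.
have [h|h|h] := ltngtP (size X) (size Y); last by constructor 1.
  by constructor 2; rewrite EW size_polyN addrC size_polyDl.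
by constructor 3; rewrite EW size_polyN size_polyDl.
Qed.

Lemma size_scale_cube a P (u : {poly F}) : a != 0 -> P != 0 -> u != 0 ->
  size (a *: (P * u ^+ 3)) = (size P + 3 * (size u).-1)%N.
Proof.
move=> a0 P0 u0; rewrite size_scale // size_mul ?expf_neq0 //.
have u3 : (0 < size (u ^+ 3))%N by rewrite size_poly_gt0 expf_neq0.
by rewrite -(prednK u3) size_exp addnS mulnC.
Qed.

(** A common divisor of the two forms divides det * X and det * Y, by Cramer. *)
Lemma coprimep_linear_forms (a b c d : F) X Y :
  a * d - b * c != 0 -> coprimep X Y ->
  coprimep (a *: X + b *: Y) (c *: X + d *: Y).
Proof.
move=> det0 /coprimepP cXY; apply/coprimepP => g g1 g2; apply: cXY.
  rewrite -(dvdpZr _ _ det0).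
  rewrite (_ : _ *: X = d *: (a *: X + b *: Y) - b *: (c *: X + d *: Y)).
    by rewrite dvdp_sub // -mul_polyC dvdp_mull.
  by rewrite -!mul_polyC !rmorphB !rmorphM /=; ring.
rewrite -(dvdpZr _ _ det0).
rewrite (_ : _ *: Y = a *: (c *: X + d *: Y) - c *: (a *: X + b *: Y)).
  by rewrite dvdp_sub // -mul_polyC dvdp_mull.
by rewrite -!mul_polyC !rmorphB !rmorphM /=; ring.
Qed.

End CubesInPolynomials.

(** * Cubic residues modulo t^2 - n *)

Section Residues.
Variable F : fieldType.
Implicit Types (n a b c d e : F) (P Q u v w : {poly F}).

Definition quad n : {poly F} := 'X^2 - n%:P.

Lemma size_quad n : size (quad n) = 3%N.
Proof. by rewrite /quad size_XnsubC. Qed.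

Lemma quad_neq0 n : quad n != 0.
Proof. by rewrite -size_poly_gt0 size_quad. Qed.

Lemma quad_irreducible n :
  (forall d, d ^+ 2 != n) -> irreducible_poly (quad n).
Proof.
move=> nsq; apply: cubic_irreducible => [|x]; first by rewrite size_quad.
by rewrite /root /quad !hornerE subr_eq0 nsq.
Qed.

Lemma quad_mod m n : quad n %| quad m - (n - m)%:P.
Proof.
rewrite (_ : _ - _ = quad n) ?dvdpp //.
by rewrite /quad rmorphB /=; ring.
Qed.

(** F[t] / (t^2 - n) is realized as the algebra generated by a matrix of
square n, so that the norm to F is a determinant, multiplicative for free and
with no quadratic extension to construct. *)
Definition sqrt_mx n : 'M[F]_2 :=
  \matrix_(i, j) (if i == j then 0 else if i == 0 then n else 1).

Lemma sqrt_mx_quad n P : quad n %| P -> horner_mx (sqrt_mx n) P = 0.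
Proof.
move=> /dvdpP[q ->]; rewrite rmorphM /= /quad rmorphB /= rmorphXn /=.
rewrite horner_mx_X horner_mx_C.
rewrite (_ : _ - _ = 0) ?mulr0 //.
apply/matrixP=> i j; rewrite expr2 !mxE big_ord_recl big_ord1 !mxE.
case: i => -[|[|i]] // hi; case: j => -[|[|j]] // hj /=.
all: ring.
Qed.

Definition quad_norm n P := \det (horner_mx (sqrt_mx n) P).

(** By Bezout, P becomes invertible in the residue ring. *)
Lemma quad_norm_neq0 n P : coprimep P (quad n) -> quad_norm n P != 0.
Proof.
case/Bezout_eq1_coprimepP=> -[u v] /= E.
have := congr1 (horner_mx (sqrt_mx n)) E.
rewrite rmorphD rmorph1 /= [X in _ + X]sqrt_mx_quad ?addr0; last first.
  exact: dvdp_mull.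
rewrite rmorphM /= => /(congr1 determinant); rewrite det_mulmx det1 => D.
by apply: contraTneq (oner_neq0 F) => N0; rewrite -D [X in _ * X]N0 mulr0 eqxx.
Qed.

(** Modulo t^2 - n the relation reads (c e1) v^3 = - (d e2) w^3. The norm of an
element of F is its square, so (d e2 / (c e1))^2 is the cube of N v / N w; and a
quotient whose square is a cube is itself a cube, being its own cube divided by
its square. *)
Lemma cube_residue n c d e1 e2 (P1 P2 v w X : {poly F}) :
  X + c *: (P1 * v ^+ 3) + d *: (P2 * w ^+ 3) = 0 -> quad n %| X ->
  quad n %| P1 - e1%:P -> quad n %| P2 - e2%:P ->
  coprimep v (quad n) -> coprimep w (quad n) ->
  c * e1 != 0 -> d * e2 != 0 ->
  exists2 k, k != 0 & d * e2 = c * e1 * k ^+ 3.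
Proof.
move=> E dX d1 d2 cv cw; set f1 := c * e1; set f2 := d * e2 => f10 f20.
have phi (a e : F) (P u : {poly F}) : quad n %| P - e%:P ->
    horner_mx (sqrt_mx n) (a *: (P * u ^+ 3))
      = (a * e) *: horner_mx (sqrt_mx n) u ^+ 3.
  move=> dP; rewrite linearZ /= rmorphM rmorphXn /=.
  have /eqP := sqrt_mx_quad dP; rewrite rmorphB /= subr_eq0 horner_mx_C => /eqP->.
  by rewrite -mulmxE mul_scalar_mx scalerA.
have := congr1 (horner_mx (sqrt_mx n)) E.
rewrite !rmorphD rmorph0 /= sqrt_mx_quad // add0r !(phi _ _ _ _ d1, phi _ _ _ _ d2).
move/eqP; rewrite addr_eq0 => /eqP/(congr1 determinant).
rewrite -scaleN1r !detZ sqrrN expr1n mul1r.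
have detX u : \det (horner_mx (sqrt_mx n) u ^+ 3) = quad_norm n u ^+ 3.
  by rewrite !exprS -!mulmxE !det_mulmx /= expr0 det1.
rewrite !detX => N.
have Nv := quad_norm_neq0 cv; have Nw := quad_norm_neq0 cw.
rewrite -/f1 -/f2 in N; clearbody f1 f2.
exists (f2 / f1 / (quad_norm n v / quad_norm n w)).
  by rewrite !(mulf_eq0, invr_eq0) !negb_or f10 f20 Nv Nw.
have nz : f1 ^+ 2 * quad_norm n v ^+ 3 != 0 by rewrite mulf_neq0 ?expf_neq0.
apply: (mulIf nz).
rewrite {1}N; field.
by rewrite f10 Nv Nw.
Qed.

End Residues.

(** * The descent *)

Section CubeRootOfUnity.
Variables (F : fieldType) (om : F).
Hypotheses (om_root : om ^+ 2 + om + 1 = 0).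

Lemma omega_sqr : om ^+ 2 = - om - 1.
Proof. by apply/eqP; rewrite -subr_eq0 -om_root; apply/eqP; ring. Qed.

Lemma omega_cube : om ^+ 3 = 1.
Proof. ring: omega_sqr. Qed.

Lemma omega_neq0 : om != 0.
Proof.
by apply: contraTneq (oner_neq0 F) => o0; rewrite -omega_cube o0 expr0n eqxx.
Qed.

Lemma omega_neq1 : 3%:R != 0 :> F -> om != 1.
Proof.
move=> three; apply: contraNneq three => o1; rewrite -om_root o1.
by apply/eqP; ring.
Qed.

Lemma omega_sqr_root : (om ^+ 2) ^+ 2 + om ^+ 2 + 1 = 0.
Proof. ring: omega_sqr. Qed.

End CubeRootOfUnity.

Section Descent.
Variable F : fieldType.
Variables (b r om : F).
Hypotheses (om_root : om ^+ 2 + om + 1 = 0) (three_neq0 : 3%:R != 0 :> F).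
Hypotheses (two_neq0 : 2%:R != 0 :> F).
Hypotheses (r_nsq : forall d, d ^+ 2 != r) (b_ncube : forall d, d ^+ 3 != b).
Implicit Types (X Y W Z u v w x y z : {poly F}).

Let sextic : {poly F} := 'X^6 - (r ^+ 3)%:P.
Let om2 := omega_sqr om_root.

Lemma r_neq0 : r != 0.
Proof. by apply: contraNneq (r_nsq 0) => ->; rewrite expr0n. Qed.

Lemma b_neq0 : b != 0.
Proof. by apply: contraNneq (b_ncube 0) => ->; rewrite expr0n. Qed.

(** omega is a square, namely that of omega^2. *)
Lemma omX_r_nsq i d : d ^+ 2 != om ^+ i * r.
Proof.
have o0 := omega_neq0 om_root.
apply: contraNneq (r_nsq (d / om ^+ (2 * i))) => E.
rewrite expr_div_n E -!exprM (_ : om ^+ (2 * i * 2) = om ^+ i).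
  by rewrite mulrAC divff ?mul1r // expf_neq0.
rewrite (_ : (2 * i * 2 = 3 * i + i)%N); last by lia.
by rewrite exprD exprM omega_cube // expr1n mul1r.
Qed.

Lemma sextic_factor : sextic = quad r * quad (om * r) * quad (om ^+ 2 * r).
Proof.
rewrite /sextic /quad (polyCM om) (polyCM (om ^+ 2)) !polyC_exp.
have E : om%:P ^+ 2 = - om%:P - 1 :> {poly F}.
  by rewrite -polyC_exp om2 polyCB polyCN.
ring: E.
Qed.

Lemma sextic_neq0 : sextic != 0.
Proof. by rewrite sextic_factor !mulf_neq0 ?quad_neq0. Qed.

(** Stated for both primitive cube roots of unity z, which correspond to the two
cyclic orders in which the quadratics can be distributed over X, Y, W. *)
Lemma three_primes_apart (z : F) X Y W (a1 a2 a3 e : F) u v w :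
  z ^+ 2 + z + 1 = 0 ->
  X = quad r * (a1 *: u ^+ 3) -> Y = quad (z * r) * (a2 *: v ^+ 3) ->
  W = quad (z ^+ 2 * r) * (a3 *: w ^+ 3) ->
  a1 != 0 -> a2 != 0 -> a3 != 0 -> e != 0 ->
  a1 * a2 * a3 = b * e ^+ 3 ->
  pairwise_coprime X Y W -> X + Y + W = 0 -> False.
Proof.
move=> zr EX EY EW a10 a20 a30 e0 Ee /and3P[cXY cYW cWX] E.
have z0 := omega_neq0 zr; have z2 := omega_sqr zr; have r0 := r_neq0.
have z1 : 1 - z != 0 by rewrite subr_eq0 eq_sym omega_neq1.
have cop (P Q A B t s : {poly F}) (a d : F) : coprimep P Q -> P = A * (a *: t ^+ 3) ->
    Q = B * (d *: s ^+ 3) -> coprimep t B /\ coprimep s A.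
  move=> cPQ EP EQ; split.
    apply: (@coprimep_dvdl _ Q); first by rewrite EQ dvdp_mulr.
    apply: (coprimep_dvdr _ cPQ).
    by rewrite EP -mul_polyC dvdp_mull // dvdp_mull // dvdp_exp.
  apply: (@coprimep_dvdl _ P); first by rewrite EP dvdp_mulr.
  rewrite coprimep_sym; apply: (coprimep_dvdl _ cPQ).
  by rewrite EQ -mul_polyC dvdp_mull // dvdp_mull // dvdp_exp.
have [c1 c2] := cop _ _ _ _ _ _ _ _ cXY EX EY.
have [c3 c4] := cop _ _ _ _ _ _ _ _ cYW EY EW.
have [c5 c6] := cop _ _ _ _ _ _ _ _ cWX EW EX.
have n12 : a2 * (r - z * r) != 0.
  by rewrite (_ : _ - _ = (1 - z) * r) ?mulf_neq0 //; ring.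
have n13 : a3 * (r - z ^+ 2 * r) != 0.
  rewrite (_ : _ - _ = - ((1 - z) * (z ^+ 2 * r))); last by ring: z2.
  by rewrite mulf_neq0 // oppr_eq0 !mulf_neq0 ?expf_neq0.
have n23 : a3 * (z * r - z ^+ 2 * r) != 0.
  by rewrite (_ : _ - _ = (1 - z) * (z * r)) ?mulf_neq0 //; ring.
have n21 : a1 * (z * r - r) != 0.
  rewrite (_ : _ - _ = - ((1 - z) * r)); last by ring.
  by rewrite mulf_neq0 // oppr_eq0 mulf_neq0.
have E1 : X + a2 *: (quad (z * r) * v ^+ 3) + a3 *: (quad (z ^+ 2 * r) * w ^+ 3) = 0.
  by rewrite -E EY EW -!scalerAr.
have E2 : Y + a3 *: (quad (z ^+ 2 * r) * w ^+ 3) + a1 *: (quad r * u ^+ 3) = 0.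
  by rewrite -E EX EW -!scalerAr; ring.
have d1 : quad r %| X by rewrite EX dvdp_mulr.
have d2 : quad (z * r) %| Y by rewrite EY dvdp_mulr.
(* Modulo quad r, the quadratics in Y and W are (1 - z) r and (1 - z^2) r, and
   the quotient of these constants is 1 + z = - z^2. *)
have [k k0 Ek] := cube_residue E1 d1 (quad_mod _ _) (quad_mod _ _) c2 c5 n12 n13.
(* Modulo quad (z r), the quadratics in W and X are z (1 - z) r and - (1 - z) r. *)
have [k' k'0 Ek'] := cube_residue E2 d2 (quad_mod _ _) (quad_mod _ _) c4 c1 n23 n21.
have F1 : a3 = - (z * a2 * k ^+ 3).
  have h : (1 - z) * (z ^+ 2 * r) != 0 by rewrite !mulf_neq0 ?expf_neq0.
  apply: (mulIf h).
  transitivity (- (a3 * (r - z ^+ 2 * r))); first by ring: z2.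
  rewrite Ek; ring: (omega_cube zr).
have F2 : a1 = - (z * a3 * k' ^+ 3).
  have h : (1 - z) * r != 0 by rewrite !mulf_neq0.
  apply: (mulIf h).
  transitivity (- (a1 * (z * r - r))); first by ring.
  rewrite Ek'; ring.
(* The powers of z cancel in a1 a2 a3 = a3^3 (k' / k)^3. *)
case/eqP: (b_ncube (a3 * k' / (k * e))).
apply: (mulIf (expf_neq0 3 e0)); rewrite -Ee F2.
have -> : a2 = - (z ^+ 2 * a3 / k ^+ 3).
  rewrite F1; field: (omega_cube zr).
  by [].
by field: (omega_cube zr); rewrite k0 e0.
Qed.

(** The residue condition modulo t^2 - r gives a3 = a2 k^3; dividing
X + Y + W = 0 by a2 yields v^3 + (k w)^3 = - (a1 / a2) (t^6 - r^3) u^3, and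
a1 / a2 is b times a cube since a1 a2 a3 is. *)
Lemma all_primes_together X Y W a1 a2 a3 e u v w :
  X = sextic * (a1 *: u ^+ 3) -> Y = a2 *: v ^+ 3 -> W = a3 *: w ^+ 3 ->
  a1 != 0 -> a2 != 0 -> a3 != 0 -> u != 0 -> v != 0 -> w != 0 -> e != 0 ->
  a1 * a2 * a3 = b * e ^+ 3 ->
  pairwise_coprime X Y W -> X + Y + W = 0 ->
  exists x y z, [/\ coprimep x y, x ^+ 3 + y ^+ 3 = b *: (sextic * z ^+ 3),
     z != 0 & (size z < size (u * v * w)%R)%N].
Proof.
move=> EX EY EW a10 a20 a30 u0 v0 w0 e0 Ee /and3P[cXY cYW cWX] E.
have dX : quad r %| X by rewrite EX sextic_factor -!mulrA dvdp_mulr.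
have d1 : quad r %| 1 - 1%:P by rewrite subrr dvdp0.
have cop P (a : F) s : coprimep X P \/ coprimep P X -> P = a *: s ^+ 3 -> coprimep s (quad r).
  move=> cXP EP; have {}cXP : coprimep P X by case: cXP => //; rewrite coprimep_sym.
  apply: (coprimep_dvdl dX); apply: (coprimep_dvdr _ cXP).
  by rewrite EP -mul_polyC dvdp_mull // dvdp_exp.
have E1 : X + a2 *: (1 * v ^+ 3) + a3 *: (1 * w ^+ 3) = 0 by rewrite !mul1r -EY -EW.
have [||||k k0] := cube_residue E1 dX d1 d1.
- by apply: (cop Y a2) => //; left.
- by apply: (cop W a3) => //; right.
- by rewrite mulr1.
- by rewrite mulr1.
rewrite !mulr1 => Ek.
exists v, (k *: w), (- (e / (k * a2)) *: u); split.
- rewrite coprimepZr //; rewrite EY EW coprimepZl ?coprimepZr // in cYW.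
  by rewrite coprimep_pexpl // coprimep_pexpr in cYW.
- have h : a1 / a2 = b * (e / (k * a2)) ^+ 3.
    apply: (mulIf (_ : (k * a2) ^+ 3 != 0)); first by rewrite expf_neq0 ?mulf_neq0.
    transitivity (b * e ^+ 3); last by field; rewrite k0 a20.
    by rewrite -Ee Ek; field.
  have h3 : v ^+ 3 + (k *: w) ^+ 3 = - ((a1 / a2) *: (sextic * u ^+ 3)).
    apply: (scalerI a20); apply/eqP.
    rewrite scalerN scalerA mulrCA divff // mulr1 -addr_eq0; apply/eqP.
    rewrite -[RHS]E EX EY EW Ek -!mul_polyC (polyCM a2) polyC_exp; ring.
  rewrite h3 h; move: (e / (k * a2)) => c.
  rewrite -!mul_polyC (polyCM b) polyC_exp polyCN; ring.
- by rewrite scaler_eq0 negb_or u0 oppr_eq0 mulf_neq0 ?invr_eq0 ?mulf_neq0.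
rewrite size_scale; last by rewrite oppr_eq0 mulf_neq0 ?invr_eq0 ?mulf_neq0.
rewrite !size_mul ?mulf_neq0 //.
have su : (0 < size u)%N by rewrite size_poly_gt0.
have sv : (0 < size v)%N by rewrite size_poly_gt0.
have sw : (0 < size w)%N by rewrite size_poly_gt0.
have [|vw1] := boolP ((size v == 1) && (size w == 1))%N; last first.
  clear -su sv sw vw1; move: (size u) (size v) (size w) su sv sw vw1.
  by move=> m1 m2 m3; lia.
case/andP=> /eqP sv1 /eqP sw1.
(* Constant v and w would make Y and W constant, but not X = - (Y + W). *)
have sX : size X = (7 + 3 * (size u).-1)%N.
  by rewrite EX -scalerAr size_scale_cube ?sextic_neq0 // size_XnsubC.
have sY : size Y = 1%N.
  by rewrite EY -[v ^+ 3]mul1r size_scale_cube ?oner_neq0 // size_poly1 sv1.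
have sW : size W = 1%N.
  by rewrite EW -[w ^+ 3]mul1r size_scale_cube ?oner_neq0 // size_poly1 sw1.
have EXn : X = - (Y + W) by apply/eqP; rewrite -addr_eq0 addrA E.
have : (size X <= 1)%N by rewrite EXn size_polyN (leq_trans (size_polyD _ _)) // sY sW.
by rewrite sX.
Qed.

Definition descent_triple X Y W Z :=
  [/\ Z != 0, X + Y + W = 0, X * Y * W = b *: (sextic * Z ^+ 3)
    & pairwise_coprime X Y W].

Definition smaller_solution n :=
  exists x y z, [/\ coprimep x y, x ^+ 3 + y ^+ 3 = b *: (sextic * z ^+ 3),
     z != 0 & (size z < n)%N].

(** Each summand has degree deg P_i modulo 3, and two of three polynomials with
sum 0 have the same degree. *)
Lemma degree_mod3_contra (P1 P2 P3 : {poly F}) (a1 a2 a3 : F) u v w :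
  [/\ a1 != 0, a2 != 0 & a3 != 0] -> [/\ u != 0, v != 0 & w != 0] ->
  [/\ P1 != 0, P2 != 0 & P3 != 0] ->
  uniq [:: size P1 %% 3; size P2 %% 3; size P3 %% 3]%N ->
  P1 * (a1 *: u ^+ 3) + P2 * (a2 *: v ^+ 3) + P3 * (a3 *: w ^+ 3) <> 0.
Proof.
case=> a10 a20 a30 [u0 v0 w0] [P10 P20 P30] distinct.
have sz (a : F) (P t : {poly F}) : a != 0 -> P != 0 -> t != 0 ->
    (size P %% 3 = size (P * (a *: t ^+ 3))%R %% 3)%N.
  by move=> *; rewrite -scalerAr size_scale_cube // addnC mulnC modnMDl.
move: distinct; rewrite (sz _ _ _ a10 P10 u0) (sz _ _ _ a20 P20 v0) (sz _ _ _ a30 P30 w0).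
move=> distinct /sum3_eq0_size[] E; move: distinct;
  by rewrite /= E !inE ?eqxx ?orbT //= andbF.
Qed.

(** The cases where t^2 - r divides the first of the three factors; the other
cases follow by rotating X, Y, W. The nine distributions of the other two
quadratics are treated in the order XX, XY, XW, YX, YY, YW, WX, WY, WW. *)
Lemma descent_step_first X1 Y W Z :
  Z != 0 -> quad r * X1 + Y + W = 0 ->
  X1 * Y * W = quad (om * r) * (quad (om ^+ 2 * r) * (b *: Z ^+ 3)) ->
  pairwise_coprime (quad r * X1) Y W -> pairwise_coprime X1 Y W ->
  smaller_solution (size Z).
Proof.
move=> Z0 E EM cop1 cop.
have irr1 : irreducible_poly (quad (om * r)).
  by apply: quad_irreducible => d; rewrite -[om]expr1 omX_r_nsq.
have irr2 : irreducible_poly (quad (om ^+ 2 * r)).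
  by apply: quad_irreducible => d; rewrite omX_r_nsq.
have q0 := @quad_neq0 F.
have qq0 (m n : F) : quad m * quad n != 0 :> {poly F} by rewrite mulf_neq0.
have s1 := size_poly1 F; have sq := @size_quad F.
have sqq (m n : F) : size (quad m * quad n) = 5%N.
  by rewrite size_mul ?q0 // !sq.
case: (prime_factor_split irr1 EM cop) => -[T [ET {}EM {}cop]];
  case: (prime_factor_split irr2 EM cop) => -[T' [ET' {}EM {}cop]];
  have [a1 [a2 [a3 [u [v [w [[Eu Ev Ew] a0 t0 [e e0 Ee] sZ]]]]]]] :=
    pairwise_coprime_mul_cube b_neq0 Z0 cop EM; subst; case: (a0) (t0) => a10 a20 a30 [u0 v0 w0].
- have EX : quad r * (quad (om * r) * (quad (om ^+ 2 * r) * (a1 *: u ^+ 3)))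
     = sextic * (a1 *: u ^+ 3) by rewrite sextic_factor !mulrA.
  have [x [y [z H]]] := all_primes_together (erefl _) (erefl _) (erefl _)
    a10 a20 a30 u0 v0 w0 e0 Ee (eq_ind _ (fun p => pairwise_coprime p _ _) cop1 _ EX)
    (eq_ind _ (fun p => p + _ + _ = 0) E _ EX).
  by exists x, y, z; rewrite -sZ.
- case: (@degree_mod3_contra (quad r * quad (om * r)) (quad (om ^+ 2 * r)) 1
    _ _ _ _ _ _ a0 t0); rewrite ?sqq ?sq ?s1 ?mul1r ?oner_neq0 //.
  by rewrite -[RHS]E; ring.
- case: (@degree_mod3_contra (quad r * quad (om * r)) 1 (quad (om ^+ 2 * r))
    _ _ _ _ _ _ a0 t0); rewrite ?sqq ?sq ?s1 ?mul1r ?oner_neq0 //.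
  by rewrite -[RHS]E; ring.
- case: (@degree_mod3_contra (quad r * quad (om ^+ 2 * r)) (quad (om * r)) 1
    _ _ _ _ _ _ a0 t0); rewrite ?sqq ?sq ?s1 ?mul1r ?oner_neq0 //.
  by rewrite -[RHS]E; ring.
- case: (@degree_mod3_contra (quad r) (quad (om * r) * quad (om ^+ 2 * r)) 1
    _ _ _ _ _ _ a0 t0); rewrite ?sqq ?sq ?s1 ?mul1r ?oner_neq0 //.
  by rewrite -[RHS]E; ring.
- by case: (three_primes_apart om_root (erefl _) (erefl _) (erefl _)
    a10 a20 a30 e0 Ee cop1 E).
- case: (@degree_mod3_contra (quad r * quad (om ^+ 2 * r)) 1 (quad (om * r))
    _ _ _ _ _ _ a0 t0); rewrite ?sqq ?sq ?s1 ?mul1r ?oner_neq0 //.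
  by rewrite -[RHS]E; ring.
- (* The opposite cyclic order: omega is the square of z = omega^2. *)
  have Eom : om * r = (om ^+ 2) ^+ 2 * r by ring: om2.
  by case: (three_primes_apart (omega_sqr_root om_root) (erefl _) (erefl _)
    (congr1 (fun n => quad n * _) Eom) a10 a20 a30 e0 Ee cop1 E).
case: (@degree_mod3_contra (quad r) 1 (quad (om * r) * quad (om ^+ 2 * r))
    _ _ _ _ _ _ a0 t0); rewrite ?sqq ?sq ?s1 ?mul1r ?oner_neq0 //.
by rewrite -[RHS]E; ring.
Qed.

Lemma descent_step X Y W Z : descent_triple X Y W Z -> smaller_solution (size Z).
Proof.
case=> Z0 E EM cop.
have irr0 : irreducible_poly (quad r) := quad_irreducible r_nsq.
have {}EM : X * Y * W
    = quad r * (quad (om * r) * (quad (om ^+ 2 * r) * (b *: Z ^+ 3))).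
  by rewrite EM sextic_factor -!mul_polyC; ring.
case: (prime_factor_split irr0 EM cop) => -[T [ET EM' cop']].
- by subst X; apply: (descent_step_first Z0 E EM' cop cop').
- subst Y; apply: (descent_step_first (X1 := T) (Y := W) (W := X) Z0).
  + by rewrite -[RHS]E; ring.
  + by rewrite -[RHS]EM'; ring.
  + exact: pairwise_coprimeC.
  exact: pairwise_coprimeC.
subst W; apply: (descent_step_first (X1 := T) (Y := X) (W := Y) Z0).
- by rewrite -[RHS]E; ring.
- by rewrite -[RHS]EM'; ring.
- by do 2!apply: pairwise_coprimeC.
by do 2!apply: pairwise_coprimeC.
Qed.

(** The factors of x^3 + y^3 over F are scaled by powers of omega so as to sum to
0; they are pairwise coprime because 1, omega, omega^2 are distinct. *)
Lemma no_coprime_solution x y z :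
  coprimep x y -> z != 0 -> x ^+ 3 + y ^+ 3 <> b *: (sextic * z ^+ 3).
Proof.
have [n] := ubnP (size z); elim: n x y z => // n IH x y z lez cxy z0 E.
have Eo : om%:P ^+ 2 = - om%:P - 1 :> {poly F}.
  by rewrite -polyC_exp om2 polyCB polyCN.
have [x' [y' [z' [cxy' E' z'0 ltz]]]] : smaller_solution (size z).
  have det1 : om - 1 != 0 by rewrite subr_eq0 omega_neq1.
  have det2 : om != 0 := omega_neq0 om_root.
  apply: (@descent_step (x + y) (om *: x + om ^+ 2 *: y) (om ^+ 2 *: x + om *: y)).
  split=> //.
  - rewrite -!mul_polyC polyC_exp; ring: Eo.
  - rewrite -E -!mul_polyC polyC_exp; ring: Eo.
  apply/and3P; split.
  - rewrite -[X in coprimep (X + _)]scale1r -[X in coprimep (_ + X)]scale1r.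
    apply: coprimep_linear_forms => //.
    by rewrite (_ : _ - _ = (om - 1) * om) ?mulf_neq0 //; ring.
  - apply: coprimep_linear_forms => //.
    rewrite (_ : _ - _ = (om - 1) * om) ?mulf_neq0 //; ring: om2.
  rewrite -[X in coprimep _ (X + _)]scale1r -[X in coprimep _ (_ + X)]scale1r.
  apply: coprimep_linear_forms => //.
  by rewrite (_ : _ - _ = (om - 1) * om) ?mulf_neq0 //; ring.
by apply: (IH x' y' z') => //; apply: leq_trans ltz _; rewrite -ltnS.
Qed.

(** Needed to make a solution primitive: a common factor g of x and y has its cube
dividing (t^6 - r^3) z^3, and must be cancelled from z as well. *)
Lemma sextic_separable : separable_poly sextic.
Proof.
have r30 : r ^+ 3 != 0 by rewrite expf_neq0 // r_neq0.
have six0 : 6%:R != 0 :> F by rewrite (natrM _ 2 3) mulf_neq0.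
rewrite unlock; apply/Bezout_eq1_coprimepP.
exists (- (r ^+ 3)^-1%:P, 6%:R^-1%:P * (r ^+ 3)^-1%:P * 'X) => /=.
rewrite derivB derivXn derivC subr0 /=.
have Er : (r ^+ 3)^-1%:P * (r ^+ 3)%:P = 1 :> {poly F} by rewrite -polyCM mulVf.
have E6 : 6%:R^-1%:P * 6%:R = 1 :> {poly F} by rewrite -polyC_natr -polyCM mulVf.
transitivity ((r ^+ 3)^-1%:P * (r ^+ 3)%:P
  + (6%:R^-1%:P * 6%:R - 1) * (r ^+ 3)^-1%:P * 'X^6 : {poly F}).
  by rewrite /sextic; move: (r ^+ 3)%:P (r ^+ 3)^-1%:P 6%:R^-1%:P => c d i; ring.
by rewrite Er E6 subrr !mul0r addr0.
Qed.

(** After removing gcd(g, z), the cube of what remains of g divides S, which has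
no square factors. *)
Lemma separable_cube_dvd (S g z : {poly F}) :
  separable_poly S -> g != 0 -> g ^+ 3 %| S * z ^+ 3 -> g %| z.
Proof.
move=> sepS g0 dg; set h := gcdp g z.
have h0 : h != 0 by rewrite gcdp_eq0 (negPf g0).
have [g' eg] := dvdpP _ _ (dvdp_gcdl g z : h %| g).
have [z' ez] := dvdpP _ _ (dvdp_gcdr g z : h %| z).
have cgz : coprimep g' z'.
  have := @coprimep_div_gcd F g z; rewrite g0 -/h => /(_ isT).
  by rewrite {1}eg {1}ez !mulpK.
have dS : g' ^+ 3 %| S.
  rewrite -(Gauss_dvdpl S (coprimep_expl 3 (coprimep_expr 3 cgz))).
  rewrite -(dvdp_mul2r _ _ (expf_neq0 3 h0)) -exprMn -eg.
  by rewrite -mulrA -exprMn -ez.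
have : coprimep g' g'.
  apply: (separable_coprime sepS); apply: dvdp_trans dS.
  by rewrite -expr2 dvdp_exp2l.
rewrite coprimepp size_poly_eq1 => /eqp_dvdl g1.
by rewrite eg ez dvdp_mul2r // g1 dvd1p.
Qed.

Lemma no_solution x y z : z != 0 -> x ^+ 3 + y ^+ 3 <> b *: (sextic * z ^+ 3).
Proof.
move=> z0 E; set g := gcdp x y.
have [x' ex] := dvdpP _ _ (dvdp_gcdl x y : g %| x).
have [y' ey] := dvdpP _ _ (dvdp_gcdr x y : g %| y).
have rhs0 : b *: (sextic * z ^+ 3) != 0.
  by rewrite scaler_eq0 negb_or b_neq0 mulf_neq0 ?sextic_neq0 // expf_neq0.
have xy0 : (x != 0) || (y != 0).
  rewrite -negb_and; apply: contraNN rhs0 => /andP[/eqP x0 /eqP y0].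
  by rewrite -E x0 y0 expr0n addr0.
have g0 : g != 0 by rewrite gcdp_eq0 negb_and.
have cxy : coprimep x' y'.
  by have := coprimep_div_gcd xy0; rewrite -/g {1}ex {1}ey !mulpK.
have E' : (x' ^+ 3 + y' ^+ 3) * g ^+ 3 = b *: (sextic * z ^+ 3).
  by rewrite -E mulrDl -!exprMn -ex -ey.
have /dvdpP[z' ez] : g %| z.
  apply: (separable_cube_dvd sextic_separable g0).
  by rewrite -(dvdpZr _ _ b_neq0) -E' dvdp_mull.
apply: (@no_coprime_solution x' y' z' cxy).
  by apply: contraNneq z0 => z'0; rewrite ez z'0 mul0r.
apply: (mulIf (expf_neq0 3 g0)).
by rewrite E' ez exprMn -!scalerAl mulrA.
Qed.

End Descent.

(** * Lines and a cubic with three flexes on the line at infinity *)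

Section Lines.
Variable K : fieldType.
Implicit Types (C : {mpoly K[3]}) (P Q R S : {vspace 'rV[K]_3}).

Lemma vline_scale (V : vectType K) (k : K) (v : V) : k != 0 -> (<[k *: v]> = <[v]>)%VS.
Proof.
move=> k0; apply/eqP; rewrite eqEsubv -!memvE rpredZ ?memv_line //=.
by rewrite -[X in X \in _](scalerK k0) rpredZ ?memv_line.
Qed.

Lemma binary_root_proportional (u w : 'rV[K]_2) :
  u != 0 -> w != 0 -> (root_form u).@[w 0] = 0 -> exists2 k, k != 0 & w = k *: u.
Proof.
move=> u0 w0; rewrite /root_form mevalB !mevalZ !mevalXU => /eqP; rewrite subr_eq0 => /eqP E.
have ext (x y : 'rV[K]_2) : x 0 0 = y 0 0 -> x 0 1 = y 0 1 -> x = y.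
  move=> e0 e1; apply/rowP=> i; case: (ltngtP i 1) => // hi.
  - by rewrite (_ : i = 0) //; apply: val_inj; case: i hi => -[].
  - by case: i hi => -[|[|]].
  by rewrite (_ : i = 1) //; apply: val_inj.
have [k Ek] : exists k, w = k *: u.
  have [u00|u00] := eqVneq (u 0 0) 0; last first.
    exists (w 0 0 / u 0 0); apply: ext; rewrite !mxE ?divfK //.
    by apply: (mulfI u00); rewrite -E; field.
  have u01 : u 0 1 != 0.
    by apply: contraNneq u0 => u01; apply/eqP/ext; rewrite ?u00 ?u01 mxE.
  exists (w 0 1 / u 0 1); apply: ext; rewrite !mxE ?divfK //.
  rewrite u00 mulr0; apply: (mulfI u01); by rewrite E u00 mul0r mulr0.
by exists k => //; apply: contraNneq w0 => k0; rewrite Ek k0 scale0r.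
Qed.

Lemma restrict_line_eval C M (w : 'rV[K]_2) :
  (restrict_line C M).@[w 0] = C.@[(w *m M) 0].
Proof.
rewrite comp_mpoly_meval; apply: meval_eq => i.
rewrite tnth_mktuple mxE raddf_sum /=; apply: eq_bigr => k _.
by rewrite mevalZ mevalXU mulrC.
Qed.

Definition homogeneous_cubic C :=
  forall (k : K) (v : 'rV[K]_3), C.@[(k *: v) 0] = k ^+ 3 * C.@[v 0].

Lemma on_curve_line C (v : 'rV[K]_3) : homogeneous_cubic C -> v != 0 ->
  on_curve C <[v]> = (C.@[v 0] == 0).
Proof.
move=> homC v0; rewrite /on_curve dim_vline v0 /=.
have /vlineP[k Ek] := memv_pick <[v]>.
have k0 : k != 0.
  apply: contraNneq v0 => k0; move/eqP: Ek; rewrite k0 scale0r vpick0.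
  by rewrite -dimv_eq0 dim_vline eqb0 negbK.
by rewrite Ek homC mulf_eq0 expf_eq0 /= (negPf k0).
Qed.

(** The geometric content of [line_section] used to rule out third intersection
points: the line L carries P, Q, R and no other point of the curve. The vector
space L is the row space of the parametrization, and a point of L on the curve
must be a zero of one of the three root forms. *)
Lemma line_sectionP C P Q R : homogeneous_cubic C -> line_section C P Q R ->
  exists L : {vspace 'rV[K]_3},
    [/\ forall S, S \in [:: P; Q; R] -> (S <= L)%VS /\ on_curve C S
      & forall S, on_curve C S -> (S <= L)%VS -> S \in [:: P; Q; R]].
Proof.
move=> homC [M [u [v [w [k [freeM [u0 v0 w0] [-> -> ->] k0 E]]]]]].
pose f : 'Hom('rV[K]_2, 'rV[K]_3) := linfun (mulmxr M).
have fE x : f x = x *m M by rewrite lfunE.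
have M0 (x : 'rV[K]_2) : x != 0 -> x *m M != 0.
  by rewrite mulmx_free_eq0.
have ev (x : 'rV[K]_2) : C.@[(x *m M) 0] =
    k * ((root_form u).@[x 0] * (root_form v).@[x 0] * (root_form w).@[x 0]).
  by rewrite -restrict_line_eval E mevalZ !mevalM.
have self (x : 'rV[K]_2) : (root_form x).@[x 0] = 0.
  by rewrite /root_form mevalB !mevalZ !mevalXU mulrC subrr.
exists (limg f); split=> S.
  rewrite !inE => /or3P[] /eqP->; (split; first by rewrite -memvE -fE memv_img ?memvf);
    by rewrite on_curve_line ?M0 // ev !self ?(mul0r, mulr0).
move=> /andP[/eqP dS vS] SL.
have S0 : vpick S != 0 by rewrite vpick0 -dimv_eq0 dS.
have ES : S = <[vpick S]>%VS.
  by apply/eqP; rewrite eq_sym eqEdim -memvE memv_pick dim_vline S0 dS.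
have /memv_imgP[x _] := subvP SL _ (memv_pick S); rewrite fE => Ex.
have x0 : x != 0 by apply: contraNneq S0 => x0; rewrite Ex x0 mul0mx.
rewrite Ex ev !mulf_eq0 (negPf k0) /= in vS; rewrite ES Ex !inE.
have prop y : y != 0 -> (root_form y).@[x 0] == 0 -> (<[x *m M]> == <[y *m M]>)%VS.
  move=> y0 /eqP/(binary_root_proportional y0 x0)[j j0 ->].
  by rewrite -scalemxAl vline_scale.
by case/orP: vS => [/orP[]|] /prop-> //; rewrite ?orbT.
Qed.

End Lines.

Section DiagonalCubic.
Variables (K : fieldType) (om T s t6 c beta : K).
Hypotheses (om_root : om ^+ 2 + om + 1 = 0) (three_neq0 : 3%:R != 0 :> K).
Hypotheses (T_neq0 : T != 0) (s_neq0 : s != 0).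
Hypotheses (T_cube : T ^+ 3 = t6) (s_cube : s ^+ 3 = c).
Hypotheses (beta_neq0 : beta != 0) (t6_neq_c : t6 != c).

(** The shape of the generic fiber, with T, s, t6, c, beta in the roles of
t^2, r, t^6, c, b. *)
Definition diagonal_cubic : {mpoly K[3]} :=
  t6 *: ('X_1 ^+ 3 - beta *: 'X_2 ^+ 3) - c *: ('X_0 ^+ 3 - beta *: 'X_2 ^+ 3).
Let C := diagonal_cubic.
Let om2 := omega_sqr om_root.

Lemma diagonal_cubic_eval (v : 'I_3 -> K) :
  C.@[v] = t6 * (v 1 ^+ 3 - beta * v 2 ^+ 3) - c * (v 0 ^+ 3 - beta * v 2 ^+ 3).
Proof.
by rewrite /C /diagonal_cubic !(mevalB, mevalZ, rmorphXn) /= !mevalXU.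
Qed.

Lemma diagonal_cubic_homogeneous : homogeneous_cubic C.
Proof. by move=> k v; rewrite !diagonal_cubic_eval !mxE; ring. Qed.

(** The points of the line X_2 = 0 on the cubic, indexed so that i |-> [inf_pt i]
is the group isomorphism. *)
Definition inf_vec (i : 'Z_3) : 'rV[K]_3 := \row_(j < 3) [:: om ^+ i * T; s; 0]`_j.
Definition inf_pt (i : 'Z_3) := proj_pt (om ^+ i * T) s 0.

Lemma omX_inj : injective (fun i : 'Z_3 => om ^+ i).
Proof.
have o1 := omega_neq1 om_root three_neq0; have o0 := omega_neq0 om_root.
have o21 : om ^+ 2 != 1.
  apply: contraNneq o1 => E; rewrite -(omega_cube om_root) exprS E mulr1 //.
have o2 : om ^+ 2 != om by rewrite -[X in _ == X]mulr1 expr2 (inj_eq (mulfI o0)).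
have ne := (negPf o1, negPf o21, negPf o2, eq_sym 1 om, eq_sym 1 (om ^+ 2), eq_sym om (om ^+ 2)).
case=> -[|[|[|i]]] hi // [] -[|[|[|j]]] hj //= /eqP; rewrite ?expr0 ?expr1 ?ne //;
  move=> _; exact: val_inj.
Qed.

Lemma inf_vec_neq0 i : inf_vec i != 0.
Proof.
by apply: contraNneq s_neq0 => /rowP/(_ 1); rewrite !mxE /= => ->.
Qed.

Lemma inf_pt_inj : injective inf_pt.
Proof.
move=> i j E; apply: omX_inj.
have : inf_vec i \in inf_pt j by rewrite -E memv_line.
case/vlineP=> k /rowP Ek.
have := Ek 1; rewrite !mxE /= => E1.
have k1 : k = 1 by apply: (mulIf s_neq0); rewrite mul1r -E1.
by have := Ek 0; rewrite !mxE /= k1 mul1r => /(mulIf T_neq0).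
Qed.

Lemma inf_pt_on_curve i : on_curve C (inf_pt i).
Proof.
rewrite (on_curve_line diagonal_cubic_homogeneous (inf_vec_neq0 i)).
rewrite diagonal_cubic_eval !mxE /=; apply/eqP.
rewrite exprMn -exprM mulnC exprM (omega_cube om_root) expr1n -s_cube -T_cube.
ring.
Qed.

Lemma inf_pt_collinear i j l : i != j -> (inf_pt l <= inf_pt i + inf_pt j)%VS.
Proof.
move=> ij; rewrite -memvE.
have d0 : om ^+ i - om ^+ j != 0 by rewrite subr_eq0 (inj_eq omX_inj).
pose a := (om ^+ l - om ^+ j) / (om ^+ i - om ^+ j).
rewrite (_ : \row__ _ = a *: inf_vec i + (1 - a) *: inf_vec j).
  by rewrite memv_add ?rpredZ ?memv_line.
apply/rowP=> -[[|[|[|k]]] hk] //; rewrite !mxE /=; last by ring.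
  by rewrite /a; field.
by ring.
Qed.

Lemma sum_ord2 (V : zmodType) (f : 'I_2 -> V) : \sum_(k < 2) f k = f 0 + f 1.
Proof. by rewrite big_ord_recl big_ord1; congr (_ + f _); apply: val_inj. Qed.

Lemma restrict_diagonal_cubic (M : 'M[K]_(2, 3)) (l : 'I_3 -> {mpoly K[2]}) :
  (forall j, l j = M 0 j *: 'X_0 + M 1 j *: 'X_1) ->
  restrict_line C M =
    t6 *: (l 1 ^+ 3 - beta *: l 2 ^+ 3) - c *: (l 0 ^+ 3 - beta *: l 2 ^+ 3).
Proof.
move=> El; rewrite /restrict_line /C /diagonal_cubic.
rewrite !(comp_mpolyB, comp_mpolyZ, rmorphXn) /= !comp_mpolyXU -!tnth_nth !tnth_mktuple.
by rewrite !El !sum_ord2.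
Qed.

Lemma mpolyC_exp n (x : K) k : (x ^+ k)%:MP_[n] = x%:MP_[n] ^+ k.
Proof. exact: rmorphXn. Qed.

(** The tangent is the line through [inf_pt i] and (0 : 0 : 1); on it the cubic
restricts to a multiple of X_2^3. *)
Lemma line_section_flex i : line_section C (inf_pt i) (inf_pt i) (inf_pt i).
Proof.
pose M : 'M[K]_(2, 3) := \matrix_(a, j) if a == 0 then inf_vec i 0 j else (j == 2)%:R.
pose e : 'rV[K]_2 := delta_mx 0 0.
have eM : e *m M = inf_vec i by rewrite -rowE; apply/rowP=> j; rewrite !mxE.
have e0 : e != 0.
  by apply: contraNneq (oner_neq0 K) => /rowP/(_ 0); rewrite !mxE /= => /eqP.
exists M, e, e, e, (beta * (t6 - c)); split=> //.
- apply: inj_row_free => v /rowP vM.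
  have := vM 1; have := vM 2; rewrite !mxE !sum_ord2 !mxE /= => v1 v0.
  have {}v0 : v 0 0 = 0 by apply: (mulIf s_neq0); rewrite mul0r -[RHS]v0 mulr0 addr0.
  have {}v1 : v 0 1 = 0 by rewrite -[RHS]v1 mulr0 add0r mulr1.
  apply/rowP=> -[[|[|a]] ha] //; rewrite mxE; [rewrite -[RHS]v0|rewrite -[RHS]v1];
    by congr (v 0 _); apply: val_inj.
- by rewrite eM.
- by rewrite mulf_neq0 // subr_eq0.
rewrite (restrict_diagonal_cubic (M := M) (fun j => erefl)) /root_form !mxE /=.
rewrite -!mul_mpolyC -T_cube -s_cube (mpolyCM _ beta) mpolyCB (mpolyCM _ (om ^+ i)).
rewrite !mpolyC_exp mpolyC0 mpolyC1.
have o3 : (om%:MP_[2] ^+ i) ^+ 3 = 1.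
  by rewrite -!mpolyC_exp -exprM mulnC exprM (omega_cube om_root) expr1n mpolyC1.
ring: o3.
Qed.

(** On X_2 = 0 the cubic restricts to T^3 X_1^3 - s^3 X_0^3, which splits into the
linear forms s X_0 - omega^a T X_1 up to sign. *)
Lemma line_section_infinity i j k : uniq [:: i; j; k] ->
  line_section C (inf_pt i) (inf_pt j) (inf_pt k).
Proof.
move=> ijk.
pose M : 'M[K]_(2, 3) := pid_mx 2.
pose u (a : 'Z_3) : 'rV[K]_2 := \row_(j < 2) [:: om ^+ a * T; s]`_j.
have uM a : u a *m M = inf_vec a.
  apply/rowP=> -[[|[|[|l]]] hl] //; rewrite !mxE !big_ord_recl big_ord0 !mxE /=; ring.
have u0 a : u a != 0.
  by apply: contraNneq (inf_vec_neq0 a) => E; rewrite -uM E mul0mx.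
exists M, (u i), (u j), (u k), (-1); split=> //.
- by rewrite /row_free rank_pid_mx.
- by rewrite !uM.
- by rewrite oppr_eq0 oner_eq0.
rewrite (restrict_diagonal_cubic (M := M) (fun j => erefl)) /root_form !mxE /=.
rewrite -!mul_mpolyC -T_cube -s_cube !(mpolyCM _ (om ^+ _)) !mpolyC_exp mpolyC0 mpolyC1.
rewrite mpolyCN mpolyC1.
have o2 : om%:MP_[2] ^+ 2 = - om%:MP_[2] - 1.
  by rewrite -mpolyC_exp om2 mpolyCB mpolyCN mpolyC1.
clear -o2 ijk; case: i j k ijk => -[|[|[|i]]] hi // [] -[|[|[|j]]] hj // [] -[|[|[|k]]] hk // _;
  rewrite /=; ring: o2.
Qed.

Hypothesis no_affine_point : forall x y : K,
  t6 * (y ^+ 3 - beta) != c * (x ^+ 3 - beta).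

Lemma curve_points S : on_curve C S -> exists i, S = inf_pt i.
Proof.
move=> /andP[/eqP dS]; rewrite diagonal_cubic_eval; set v := vpick S.
have v_neq0 : v != 0 by rewrite vpick0 -dimv_eq0 dS.
have ES : S = <[v]>%VS.
  by apply/eqP; rewrite eq_sym eqEdim -memvE memv_pick dim_vline v_neq0 dS.
have [v2|v2] := eqVneq (v 0 2) 0; last first.
  rewrite subr_eq0 => E; case/negP: (no_affine_point (v 0 0 / v 0 2) (v 0 1 / v 0 2)).
  apply/eqP/(mulIf (expf_neq0 3 v2)); move/eqP: E => E.
  transitivity (t6 * (v 0 1 ^+ 3 - beta * v 0 2 ^+ 3)); first by field.
  by rewrite E; field.
rewrite v2 -T_cube -s_cube => /eqP E.
have : (T * v 0 1 - s * v 0 0) * (om * (T * v 0 1) - s * v 0 0)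
         * (om ^+ 2 * (T * v 0 1) - s * v 0 0) = 0.
  rewrite -[RHS]E; ring: om2.
have pt (i : 'Z_3) : om ^+ i * (T * v 0 1) - s * v 0 0 = 0 -> exists i, S = inf_pt i.
  move=> /eqP; rewrite subr_eq0 => /eqP Ei; exists i; rewrite ES.
  have Ev : v = (v 0 1 / s) *: inf_vec i.
    apply/rowP=> -[[|[|[|l]]] hl] //; rewrite !mxE /=.
    - apply: (mulfI s_neq0); rewrite (_ : v 0 _ = v 0 0); last by congr (v 0 _); apply: val_inj.
      by rewrite -Ei; field.
    - by rewrite divfK //; congr (v 0 _); apply: val_inj.
    - by rewrite mulr0 -v2; congr (v 0 _); apply: val_inj.
  rewrite {1}Ev vline_scale //.
  by apply: contraNneq v_neq0 => h; rewrite Ev h scale0r.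
move/eqP; rewrite !mulf_eq0 => /orP[/orP[]|] /eqP h.
- by apply: (pt 0); rewrite expr0 mul1r.
- by apply: (pt 1); rewrite expr1.
exact: (pt 2).
Qed.

(** Three elements of Z/3 have sum 0 exactly when they are all equal or all
different. A line through two different points at infinity contains all three
of them, hence they are exhausted by the section; this excludes a section with
precisely two different points. *)
Lemma line_section_inf_pt i j R :
  line_section C (inf_pt i) (inf_pt j) R <-> R = inf_pt (- (i + j)).
Proof.
split=> [sec|->]; last first.
  have [->|ij] := eqVneq i j.
    rewrite (_ : - _ = j); first exact: line_section_flex.
    by case: j => -[|[|[|j]]] hj //; apply: val_inj.
  apply: line_section_infinity; move: ij.
  by case: i j => -[|[|[|i]]] hi // [] -[|[|[|j]]] hj.
have [L [HL HC]] := line_sectionP diagonal_cubic_homogeneous sec.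
have [|sR onR] := HL R; first by rewrite !inE eqxx !orbT.
have [k Ek] := curve_points onR; subst R.
congr inf_pt.
have [si _] : (inf_pt i <= L)%VS /\ on_curve C (inf_pt i) by apply: HL; rewrite !inE eqxx.
have [sj _] : (inf_pt j <= L)%VS /\ on_curve C (inf_pt j).
  by apply: HL; rewrite !inE eqxx orbT.
have all3 a b l : (inf_pt a <= L)%VS -> (inf_pt b <= L)%VS -> a != b -> l \in [:: i; j; k].
  move=> sa sb ab; have := HC _ (inf_pt_on_curve l).
  rewrite !inE !(inj_eq inf_pt_inj); apply.
  by apply: subv_trans (inf_pt_collinear l ab) _; rewrite subv_add sa.
have [ij|ij] := eqVneq i j; last first.
  have := all3 _ _ 0 si sj ij; have := all3 _ _ 1 si sj ij; have := all3 _ _ 2 si sj ij.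
  move: ij; rewrite !inE; clear.
  by case: i j k => -[|[|[|i]]] hi // [] -[|[|[|j]]] hj // [] -[|[|[|k]]] hk //= *; apply: val_inj.
have [ik|ik] := eqVneq i k.
  rewrite -ik -ij; clear; by case: i => -[|[|[|i]]] hi //; apply: val_inj.
have := all3 _ _ 0 si sR ik; have := all3 _ _ 1 si sR ik; have := all3 _ _ 2 si sR ik.
move: ik; rewrite !inE -ij; clear.
by case: i k => -[|[|[|i]]] hi // [] -[|[|[|k]]] hk.
Qed.

Lemma diagonal_cubic_group : cubic_group_iso C (proj_pt T s 0) 'Z_3.
Proof.
have E0 : proj_pt T s 0 = inf_pt 0 by rewrite /inf_pt expr0 mul1r.
pose f (i : 'Z_3) : curve_pt C := exist _ (inf_pt i) (inf_pt_on_curve i).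
exists f; split; last first.
  move=> x y z /=; rewrite E0; split=> [[R [/line_section_inf_pt-> /line_section_inf_pt]]|->].
    by rewrite add0r opprK => /inf_pt_inj.
  exists (inf_pt (- (x + y))); split; apply/line_section_inf_pt => //.
  by rewrite add0r opprK.
pose g (P : curve_pt C) : 'Z_3 := odflt 0 [pick i | inf_pt i == val P].
have gP i (P : curve_pt C) : inf_pt i = val P -> g P = i.
  move=> E; rewrite /g; case: pickP => [j /eqP Ej|/(_ i)]; last by rewrite E eqxx.
  by apply: inf_pt_inj; rewrite E.
exists g => [i|P]; first exact: gP.
have [i Ei] := curve_points (valP P).
by apply: val_inj; rewrite /= (gP i).
Qed.

End DiagonalCubic.

(** * The generic fiber over a finite field *)

(** Cubing is not surjective, hence not injective; two elements with the same cube
have a primitive cube root of unity as quotient. *)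
Lemma exists_omega (F : finFieldType) (b : F) :
  (forall d : F, d ^+ 3 != b) -> exists om : F, om ^+ 2 + om + 1 = 0.
Proof.
move=> ncube; have /injectivePn[x [y xy Exy]] : ~~ injectiveb (fun d : F => d ^+ 3).
  apply/injectiveP => /injF_bij[g _ gK].
  by case/eqP: (ncube (g b)).
have y0 : y != 0.
  apply: contraNneq xy => y0; move/eqP: Exy.
  by rewrite y0 [in X in _ == X]expr0n expf_eq0.
have xy1 : x / y != 1 by apply: contraNneq xy => E; rewrite -[x](divfK y0) E mul1r.
have xy3 : (x / y) ^+ 3 = 1 by rewrite expr_div_n Exy divff // expf_neq0.
exists (x / y); move: (x / y) xy1 xy3 => z z1 z3.
apply: (mulfI (_ : z - 1 != 0)); first by rewrite subr_eq0.
by rewrite mulr0; transitivity (z ^+ 3 - 1); [ring | rewrite z3 subrr].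
Qed.

Lemma fractionP (R : idomainType) (x : {fraction R}) :
  exists n d : R, d != 0 /\ x = tofrac n / tofrac d.
Proof.
elim/quotW: x => x; exists \n_x, \d_x; split; first exact: denom_ratioP.
apply: (canRL (mulfK _)); first by rewrite tofrac_eq0 denom_ratioP.
unlock tofrac; rewrite -[LHS]FracField.pi_mul; apply/eqmodP.
by rewrite /= FracField.equivfE /FracField.mulf !numden_Ratio ?mulf_neq0 ?oner_eq0 ?denom_ratioP //
  !mulr1 mulrC.
Qed.

Lemma clear_denominators (K : fieldType) (t b r m1 m2 e1 e2 : K) :
  e1 != 0 -> e2 != 0 ->
  t ^+ 6 * ((m2 / e2) ^+ 3 - b) = r ^+ 3 * ((m1 / e1) ^+ 3 - b) ->
  (t ^+ 2 * m2 * e1) ^+ 3 + (- r * m1 * e2) ^+ 3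
    = b * ((t ^+ 6 - r ^+ 3) * (e1 * e2) ^+ 3).
Proof.
move=> e10 e20 E; apply/eqP; rewrite -subr_eq0; apply/eqP.
transitivity ((t ^+ 6 * ((m2 / e2) ^+ 3 - b) - r ^+ 3 * ((m1 / e1) ^+ 3 - b))
  * (e1 * e2) ^+ 3); last by rewrite E subrr mul0r.
by field; rewrite e10 e20.
Qed.

(** The substitution x := t^2 X_1 / X_2, y := - r X_0 / X_2 turns an affine point
into a solution of the equation of [no_solution]. *)
Lemma K6_no_affine_point (F : fieldType) (b r om : F) :
  om ^+ 2 + om + 1 = 0 -> 3%:R != 0 :> F -> 2%:R != 0 :> F ->
  (forall d, d ^+ 2 != r) -> (forall d, d ^+ 3 != b) ->
  forall x y : ratfun F,
    ratX F ^+ 6 * (y ^+ 3 - ratC b) != ratC (r ^+ 3) * (x ^+ 3 - ratC b).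
Proof.
move=> om_root three0 two0 r_nsq b_ncube x y; apply/eqP.
have [n1 [d1 [d10 ->]]] := fractionP x; have [n2 [d2 [d20 ->]]] := fractionP y.
have f1 : tofrac d1 != 0 by rewrite tofrac_eq0.
have f2 : tofrac d2 != 0 by rewrite tofrac_eq0.
have z0 : d1 * d2 != 0 by rewrite mulf_neq0.
move=> E; apply: (no_solution om_root three0 two0 r_nsq b_ncube z0
  (x := 'X^2 * n2 * d1) (y := - r%:P * n1 * d2)).
apply/eqP; rewrite -tofrac_eq -mul_polyC !polyC_exp; apply/eqP.
have {}E : tofrac 'X ^+ 6 * ((tofrac n2 / tofrac d2) ^+ 3 - tofrac b%:P)
    = tofrac r%:P ^+ 3 * ((tofrac n1 / tofrac d1) ^+ 3 - tofrac b%:P).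
  by move: E; rewrite /ratX /ratC polyC_exp tofracXn => E; exact: E.
rewrite tofracD !tofracXn (tofracM _ d1) (tofracM _ n2) (tofracM _ d2) (tofracM _ n1) tofracN.
rewrite (tofracM b%:P) (tofracM (_ - _)) tofracB !tofracXn (tofracM d1).
exact: clear_denominators f1 f2 E.
Qed.

Theorem theorem1 (F : finFieldType) (p : nat) (b c r : F)
    (hp : p \in [pchar F]) (hp3 : (3 < p)%N)
    (hb0 : b != 0) (hb : ~ exists d : F, d ^+ 3 = b)
    (hord : E_ordinary p b)
    (hc0 : c != 0) (hc : ~ exists d : F, d ^+ 2 = c)
    (hr : r ^+ 3 = c) :
  cubic_group_iso (K6_cubic b c) (K6_zero r) 'Z_3.
Proof.
have small n : (0 < n < p)%N -> n%:R != 0 :> F.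
  case/andP=> n0 np; rewrite -(dvdn_pcharf hp).
  by apply: contraTN np => /(dvdn_leq n0); rewrite -leqNgt.
have two0 : 2%:R != 0 :> F by apply: small; lia.
have three0 : 3%:R != 0 :> F by apply: small; lia.
have b_ncube d : d ^+ 3 != b by apply/eqP => E; apply: hb; exists d.
have r_nsq d : d ^+ 2 != r.
  by apply/eqP => E; apply: hc; exists (d ^+ 3); rewrite -hr -E; ring.
have [om om_root] := exists_omega b_ncube.
have r0 : r != 0 by apply: contraNneq hc0 => r0; rewrite -hr r0 expr0n.
have ratC0 (a : F) : a != 0 -> ratC a != 0.
  by move=> a0; rewrite /ratC tofrac_eq0 polyC_eq0.
have X0 : ratX F != 0 by rewrite /ratX tofrac_eq0 polyX_eq0.
apply: (@diagonal_cubic_group (ratfun F) (ratC om)).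
- by rewrite /ratC -tofracXn -tofracD -tofrac1 -tofracD -polyC_exp -polyCD -polyCD om_root tofrac0.
- by rewrite -tofrac1 -tofracMn tofrac_eq0 -polyC_natr polyC_eq0.
- by rewrite expf_neq0.
- exact: ratC0.
- by rewrite -exprM.
- by rewrite /ratC -tofracXn -polyC_exp hr.
- exact: ratC0.
- apply/eqP => E.
  have /eqP : tofrac 'X^6 = tofrac c%:P by rewrite tofracXn; exact: E.
  by rewrite tofrac_eq -subr_eq0 -size_poly_eq0 size_XnsubC.
by rewrite -hr; apply: (K6_no_affine_point om_root).
Qed.
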